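(* Let $a,c,d\in\mathbb{C}$, $\mathbf e\in\mathbb{C}^r$, $\mathbf f\in\mathbb{C}^s$ with $r\le s$ be such that no displayed denominator (lower) parameter is a non-positive integer. Then the following identity holds as a formal power series in $z$, and hence wherever the displayed series converge: $$ \begin{aligned} &a(c-d)(1-d)(1+c-a)\,F\!\left(\begin{matrix}c-a+2,\,1+c,\,c,\,d,\,\mathbf e+1\\ a,\,2,\,c-d+2,\,\mathbf f+1\end{matrix}\middle|z\right)F\!\left(\begin{matrix}c-a,\,c-1,\,c-1,\,d,\,\mathbf e\\ 1,\,a,\,c-d,\,\mathbf f\end{matrix}\middle|z\right)\\ &-d(c-a)(1-a)(1+c-d)\,F\!\left(\begin{matrix}c-a+1,\,c,\,c+1,\,d+1,\,\mathbf e+1\\ a+1,\,2,\,c-d+1,\,\mathbf f+1\end{matrix}\middle|z\right)F\!\left(\begin{matrix}c-a+1,\,c-1,\,c-1,\,d-1,\,\mathbf e\\ 1,\,a-1,\,c-d+1,\,\mathbf f\end{matrix}\middle|z\right)\\ &-c(a-d)(1+c-a-d)\,F\!\left(\begin{matrix}1+c-a,\,c-1,\,c-1,\,d,\,\mathbf e\\ a-1,\,1,\,c-d,\,\mathbf f\end{matrix}\middle|z\right)F\!\left(\begin{matrix}1+c-a,\,1+c,\,c+1,\,d,\,\mathbf e+1\\ a+1,\,1,\,c-d+2,\,\mathbf f+1\end{matrix}\middle|z\right)\\ &=z\,\frac{dc(a-d)(1+c-a-d)(1+c-a)(c-1)^2(\mathbf e)_1}{(c-d)(1-a)(\mathbf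 f)_1}\\ &\quad\times F\!\left(\begin{matrix}c-a+2,\,1+c,\,c,\,d,\,\mathbf e+1\\ a,\,2,\,c-d+2,\,\mathbf f+1\end{matrix}\middle|z\right)F\!\left(\begin{matrix}c-a+1,\,c,\,c+1,\,d+1,\,\mathbf e+1\\ a+1,\,2,\,c-d+1,\,\mathbf f+1\end{matrix}\middle|z\right). \end{aligned} $$
   Context: $F\!\left(\begin{smallmatrix}\mathbf x\\ \mathbf y\end{smallmatrix}\middle|z\right)=\sum_{k\ge0}\frac{\prod_i(x_i)_k}{\prod_i(y_i)_k}\frac{z^k}{k!}$ is the generalized hypergeometric series, $(x)_k=\Gamma(x+k)/\Gamma(x)$. Here each $F$ is of type ${}_{r+4}F_{s+3}$. $\mathbf e+1$, $\mathbf f+1$ mean adding $1$ to each component; $(\mathbf e)_1$ and $(\mathbf f)_1$ are the products of all components of $\mathbf e$ and $\mathbf f$ (empty product $=1$). *)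

(* Defs.v *)
From HB Require Import structures.
From mathcomp Require Import all_boot all_order all_algebra.
From mathcomp Require Export complex.
From mathcomp Require Import all_classical all_reals all_analysis.

Set Implicit Arguments.
Unset Strict Implicit.
Unset Printing Implicit Defensive.

Import Order.TTheory GRing.Theory Num.Theory.
Import numFieldNormedType.Exports.

Local Open Scope classical_set_scope.
Local Open Scope ring_scope.

(* A formal power series over K is its coefficient sequence nat -> K.         *)

Definition fps_mul (K : fieldType) (u v : nat -> K) : nat -> K :=
  fun n => \sum_(i < n.+1) u i * v (n - i)%N.

(* z * u(z) *)
Definition fps_mulX (K : fieldType) (u : nat -> K) : nat -> K :=
  fun n => if n is m.+1 then u m else 0.

Definition rising (K : fieldType) (x : K) (k : nat) : K :=
  \prod_(j < k) (x + j%:R).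

(* Coefficient of z^k in F(xs; ys | z). Division by 0 yields 0, so it is only *)
(* meaningful under nonpole ys.                                               *)
Definition hypergeom (K : fieldType) (xs ys : seq K) : nat -> K :=
  fun k => (\prod_(x <- xs) rising x k) / (\prod_(y <- ys) rising y k) / k`!%:R.

Definition nonpole (K : fieldType) (ys : seq K) : Prop :=
  forall y, y \in ys -> forall n : nat, y != - n%:R.

(* K carries the topology of its norm; for K := R[i] the norm is the complex  *)
(* modulus.                                                                   *)
Definition fps_cvg_at (K : numFieldType) (u : nat -> K) (z : K) : Prop :=
  cvgn (series (fun k => u k * z ^+ k)).

Definition fps_eval (K : numFieldType) (u : nat -> K) (z : K) : K :=
  limn (series (fun k => u k * z ^+ k)).

(* Main.v *)
(* Write phi_k for the ratio of the rising factorials of e and f. The *)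
(* coefficient of z^n is a combination of the products phi_p phi_q with *)
(* p + q = n + 1: in every product F_i F_j one factor carries e + 1, f + 1 and *)
(* hence phi_p with p shifted by one. After a common hypergeometric factor is *)
(* removed, the contribution of (p, q) is a rational function of p and q which *)
(* is antisymmetric, so that the sum vanishes for arbitrary phi. *)
(* At a point z where the six series merely converge (possibly conditionally) *)
(* the Cauchy products need not converge, but by Cesaro's theorem the means of *)
(* their partial sums tend to the products of the sums, which is enough. *)
Require Import Defs.
From mathcomp Require Import all_boot all_order all_algebra ring.
From mathcomp Require Import complex.
From mathcomp Require Import all_classical all_reals all_analysis.

Set Implicit Arguments.
Unset Strict Implicit.
Unset Printing Implicit Defensive.

Import Order.TTheory GRing.Theory Num.Theory.
Import numFieldNormedType.Exports.
Local Open Scope classical_set_scope.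
Local Open Scope ring_scope.

(** After the index shift the parameters [e] and [f] enter every product only through the common
    factor [w i * w j]. Up to constants, the i-th coefficients of [F1], [F3], [F6] are [w i] times
    (c+1)_i times a rational function of i, and the (j+1)-st coefficients of [F2], [F4], [F5] are
    [w j] times (c)_j times a rational function of j. The coefficient of z^(n+1) in the difference
    of both sides is thus a boundary term, zero by [last_term_eq0], plus the sum of [t i j] over i +
    j = n. Since c (c+1)_i = (c)_i (c+i), [c * t i j] is a symmetric factor times [(c + i) * Q i j],
    and the latter is antisymmetric by a rational function identity ([Q_antisym]). So the sum
    vanishes, which gives [hypergeom_quadratic].

    For values, the convolution of the partial sums of two convergent series, divided by n + 1,
    tends to the product of the sums ([cesaro_fps_mul]). These means are linear in the Cauchy
    product coefficients, so the formal identity passes to the limit ([fps_eval_quadratic]). *)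

(** * Rising factorials and Cauchy products *)

Lemma rising0 (K : fieldType) (x : K) : rising x 0 = 1.
Proof. exact: big_ord0. Qed.

Lemma risingS (K : fieldType) (x : K) k :
  rising x k.+1 = rising x k * (x + k%:R).
Proof. exact: big_ord_recr. Qed.

Lemma risingSl (K : fieldType) (x : K) k :
  rising x k.+1 = x * rising (x + 1) k.
Proof.
rewrite /rising big_ord_recl addr0; congr (_ * _).
by apply: eq_bigr => i _; rewrite lift0 -[_.+1%:R]nat1r addrA.
Qed.

Lemma rising_neq0 (K : fieldType) (x : K) k :
  (forall n, x != - n%:R) -> rising x k != 0.
Proof.
move=> x0; apply/prodf_neq0 => i _.
by rewrite addr_eq0.
Qed.

Lemma rising1 (K : fieldType) k : rising 1 k = k`!%:R :> K.
Proof.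
elim: k => [|k IH]; first by rewrite rising0.
by rewrite risingS IH factS natrM mulrC nat1r.
Qed.

Lemma fps_mulC (K : fieldType) (u v : nat -> K) : fps_mul u v = fps_mul v u.
Proof.
apply/funext => n; rewrite /fps_mul (reindex_inj rev_ord_inj) /=.
by apply: eq_bigr => i _; rewrite subSS subKn ?leq_ord// mulrC.
Qed.

Lemma fps_mul_mulX (K : fieldType) (u v : nat -> K) :
  fps_mul (fps_mulX u) v = fps_mulX (fps_mul u v).
Proof.
apply/funext => -[|n]; first by rewrite /fps_mul big_ord1 mul0r.
by rewrite /fps_mul big_ord_recl mul0r add0r.
Qed.

Lemma fps_mul_dilate (K : fieldType) (u v : nat -> K) (z : K) :
  fps_mul (fun k => u k * z ^+ k) (fun k => v k * z ^+ k)
  = (fun k => fps_mul u v k * z ^+ k).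
Proof.
apply/funext => n; rewrite /fps_mul mulr_suml; apply: eq_bigr => i _.
by rewrite mulrACA -exprD subnKC ?leq_ord.
Qed.

(** On generating functions [series] is multiplication by z/(1-z), so it can be moved out of either
    factor. *)
Lemma fps_mul_series (K : numFieldType) (u v : nat -> K) :
  fps_mul (series u) v = series (fps_mul u v).
Proof.
apply/funext; elim => [|n IH].
  by rewrite /fps_mul big_ord1 /series /= !big_geq// mul0r.
rewrite seriesSr -IH [in LHS]fps_mulC [fps_mul u v]fps_mulC [in RHS]fps_mulC.
rewrite {1}/fps_mul big_ord_recr /= subnn [X in _ * X]/series /= big_geq//.
rewrite mulr0 addr0.
under eq_bigr => i _.
  rewrite subSn ?leq_ord// seriesSr mulrDr; over.
by rewrite big_split /=.
Qed.

Lemma rising_shift (K : fieldType) (x : K) k :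
  x != 0 -> rising (x + 1) k = rising x k * (x + k%:R) / x.
Proof. by move=> x0; rewrite -risingS risingSl mulrAC divff ?mul1r. Qed.

Definition rising_ratio (K : fieldType) (e f : seq K) k : K :=
  (\prod_(x <- e) rising x k) / \prod_(y <- f) rising y k.

(** This index shift is the source of the factor (e)_1/(f)_1 on the right-hand side of the
    theorem. *)
Lemma rising_ratioS (K : fieldType) (e f : seq K) k :
  rising_ratio e f k.+1 = (\prod_(x <- e) x) / (\prod_(y <- f) y)
    * rising_ratio [seq x + 1 | x <- e] [seq y + 1 | y <- f] k.
Proof.
have split_rising (s : seq K) : \prod_(x <- s) rising x k.+1
    = \prod_(x <- s) x * \prod_(x <- [seq x + 1 | x <- s]) rising x k.
  rewrite big_map -big_split /=.
  by apply: eq_bigr => x _; rewrite risingSl.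
by rewrite /rising_ratio !split_rising invfM mulrACA.
Qed.

Lemma hypergeom43E (K : fieldType) (x1 x2 x3 x4 y1 y2 y3 : K) (e f : seq K) k :
  hypergeom ([:: x1; x2; x3; x4] ++ e) ([:: y1; y2; y3] ++ f) k
  = rising x1 k * rising x2 k * rising x3 k * rising x4 k
    / (rising y1 k * rising y2 k * rising y3 k) / k`!%:R * rising_ratio e f k.
Proof. by rewrite /hypergeom /rising_ratio !big_cons !invfM; ring. Qed.

(** * The identity between coefficients *)

Section Coefficients.
Variables (K : numFieldType) (a c d : K) (e f : seq K).
Hypotheses (a_pole : forall n : nat, a - 1 != - n%:R)
           (cd_pole : forall n : nat, c - d != - n%:R).

Let e1 := [seq x + 1 | x <- e].
Let f1 := [seq y + 1 | y <- f].
Let F1 := hypergeom ([:: c - a + 2; 1 + c; c; d] ++ e1)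
                    ([:: a; 2; c - d + 2] ++ f1).
Let F2 := hypergeom ([:: c - a; c - 1; c - 1; d] ++ e)
                    ([:: 1; a; c - d] ++ f).
Let F3 := hypergeom ([:: c - a + 1; c; c + 1; d + 1] ++ e1)
                    ([:: a + 1; 2; c - d + 1] ++ f1).
Let F4 := hypergeom ([:: c - a + 1; c - 1; c - 1; d - 1] ++ e)
                    ([:: 1; a - 1; c - d + 1] ++ f).
Let F5 := hypergeom ([:: 1 + c - a; c - 1; c - 1; d] ++ e)
                    ([:: a - 1; 1; c - d] ++ f).
Let F6 := hypergeom ([:: 1 + c - a; 1 + c; c + 1; d] ++ e1)
                    ([:: a + 1; 1; c - d + 2] ++ f1).

Let E := (\prod_(x <- e) x) / \prod_(y <- f) y.
(* The factor common to the i-th coefficients of F1, F3, F6 and to the (i+1)-st *)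
(* ones of F2, F4, F5. *)
Let w i := rising (c - a + 1) i * rising c i * rising d i
  / (rising a i * rising (c - d) i * i`!%:R ^+ 2) * rising_ratio e1 f1 i.

Let a0 : a != 0. Proof. by have := a_pole 1; rewrite -subr_eq0 opprK subrK. Qed.
Let a1 : a - 1 != 0. Proof. by have := a_pole 0; rewrite oppr0. Qed.
Let cd0 : c - d != 0. Proof. by have := cd_pole 0; rewrite oppr0. Qed.
Let ai n : a + n%:R != 0.
Proof. by have := a_pole n.+1; rewrite -addr_eq0 -nat1r addrA subrK. Qed.
Let cdi n : c - d + n%:R != 0.
Proof. by have := cd_pole n; rewrite -addr_eq0. Qed.
Let cd1i n : c - d + 1 + n%:R != 0.
Proof. by have := cdi n.+1; rewrite -nat1r addrA. Qed.
Let cd1 : c - d + 1 != 0. Proof. by have := cd1i 0; rewrite addr0. Qed.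
Let i1 n : n%:R + 1 != 0 :> K.
Proof. by rewrite natr1 pnatr_eq0. Qed.
Let fact0 n : n`!%:R != 0 :> K.
Proof. by rewrite pnatr_eq0 -lt0n fact_gt0. Qed.
Let ra n : rising a n != 0.
Proof. by apply: rising_neq0 => k; rewrite -addr_eq0. Qed.
Let rcd n : rising (c - d) n != 0.
Proof. exact: rising_neq0. Qed.
Let rising2 n : rising 2 n = n`!%:R * (n%:R + 1) :> K.
Proof.
by rewrite (_ : 2 = 1 + 1)// rising_shift ?oner_eq0// rising1 divr1 [1 + _]addrC.
Qed.
Let rcd2 n : rising (c - d + 2) n
  = rising (c - d) n * (c - d + n%:R) * (c - d + 1 + n%:R)
    / (c - d) / (c - d + 1).
Proof.
rewrite (_ : c - d + 2 = c - d + 1 + 1); last by ring.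
rewrite !rising_shift//; field; exact/andP.
Qed.

(** [G1] to [G6] are what remains of the coefficients of [F1] to [F6] once the common factors are
    removed. *)
Let G1 x := (c - a + 1 + x) * (c - d) * (c - d + 1)
  / ((x + 1) * (c - d + x) * (c - d + 1 + x)).
Let G3 x := (d + x) * a * (c - d) / ((a + x) * (x + 1) * (c - d + x)).
Let G6 x := (c + x) * a * (c - d) * (c - d + 1)
  / ((a + x) * (c - d + x) * (c - d + 1 + x)).
Let G2 x := (c - a) * (d + x) / ((x + 1) ^+ 2 * (a + x) * (c - d + x)).
Let G4 x := (c - a + 1 + x) * (d - 1) * (c - d)
  / ((x + 1) ^+ 2 * (a - 1) * (c - d + x) * (c - d + 1 + x)).
Let G5 x := (c - a + 1 + x) * (d + x) / ((a - 1) * (x + 1) ^+ 2 * (c - d + x)).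

(** The scalar turns (c-a+2)_i into (c-a+1)_i. It stays on the left because it may vanish; [A] and
    [D] provide it. The same holds for d in [F3E] and c in [F6E]. *)
Let F1E i : (1 + c - a) * F1 i = w i * rising (c + 1) i * G1 i%:R.
Proof.
have E1 : (1 + c - a) * rising (c - a + 2) i
    = rising (c - a + 1) i * (c - a + 1 + i%:R).
  rewrite -risingS risingSl; congr (_ * rising _ _); ring.
have pull p q r s t u v x :
    p * (q * r * s * t / u / v * x) = p * q * (r * s * t / u / v * x) :> K.
  by ring.
rewrite /F1 hypergeom43E pull E1 rising2 rcd2 [1 + c]addrC /w /G1.
by field; do ?[apply/andP; split].
Qed.

Let F3E i : d * F3 i = w i * rising (c + 1) i * G3 i%:R.
Proof.
have E1 : d * rising (d + 1) i = rising d i * (d + i%:R).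
  by rewrite -risingS risingSl.
have pull p q r s t u v x :
    p * (q * r * s * t / u / v * x) = p * t * (q * r * s / u / v * x) :> K.
  by ring.
rewrite /F3 hypergeom43E pull E1 rising2.
rewrite (rising_shift _ a0) (rising_shift _ cd0) /w /G3.
by field; do ?[apply/andP; split].
Qed.

Let cri n : c * rising (c + 1) n = rising c n * (c + n%:R).
Proof. by rewrite -risingS risingSl. Qed.

Let F6E i : c * F6 i = w i * rising (c + 1) i * G6 i%:R.
Proof.
have pull p q r s t u v x :
    p * (q * r * s * t / u / v * x) = p * r * (q * s * t / u / v * x) :> K.
  by ring.
rewrite /F6 hypergeom43E pull [1 + c]addrC cri rcd2 rising1 (rising_shift _ a0).
rewrite [c + 1 - a]addrAC /w /G6.
by field; do ?[apply/andP; split].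
Qed.

Let rc1S n : rising (c - 1) n.+1 = (c - 1) * rising c n.
Proof. by rewrite risingSl subrK. Qed.
Let ra1S n : rising (a - 1) n.+1 = (a - 1) * rising a n.
Proof. by rewrite risingSl subrK. Qed.
Let fS n : n.+1`!%:R = (n%:R + 1) * n`!%:R :> K.
Proof. by rewrite factS natrM natr1. Qed.

Let F2E j : F2 j.+1 = (c - 1) ^+ 2 * E * w j * rising c j * G2 j%:R.
Proof.
rewrite /F2 hypergeom43E rising_ratioS [rising (c - a) _]risingSl rc1S.
rewrite !risingS rising1 fS /w /G2 -/E.
by field; do ?[apply/andP; split].
Qed.

Let F4E j : F4 j.+1 = (c - 1) ^+ 2 * E * w j * rising c j * G4 j%:R.
Proof.
rewrite /F4 hypergeom43E rising_ratioS [rising (d - 1) _]risingSl subrK.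
rewrite rc1S ra1S rising1 fS 2!risingS (rising_shift _ cd0) /w /G4 -/E.
by field; do ?[apply/andP; split].
Qed.

Let F5E j : F5 j.+1 = (c - 1) ^+ 2 * E * w j * rising c j * G5 j%:R.
Proof.
rewrite /F5 hypergeom43E rising_ratioS rc1S ra1S [1 + c]addrC [c + 1 - a]addrAC.
rewrite rising1 fS !risingS /w /G5 -/E.
by field; do ?[apply/andP; split].
Qed.

Let A := a * (c - d) * (1 - d) * (1 + c - a).
Let B := d * (c - a) * (1 - a) * (1 + c - d).
Let C := c * (a - d) * (1 + c - a - d).
Let D := d * c * (a - d) * (1 + c - a - d) * (1 + c - a) * (c - 1) ^+ 2
  * (\prod_(x <- e) x) / ((c - d) * (1 - a) * (\prod_(y <- f) y)).

Let na1 : 1 - a != 0. Proof. by rewrite -oppr_eq0 opprB. Qed.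

Let F0 xs ys : hypergeom xs ys 0 = 1 :> K.
Proof.
rewrite /hypergeom !big1 ?divr1// => *; exact: rising0.
Qed.

(** These are the terms in which [F2], [F4], [F5] contribute their constant coefficient 1; they have
    no counterpart on the right-hand side and cancel among themselves. *)
Let last_term_eq0 i :
  A * (F1 i * F2 0) - B * (F3 i * F4 0) - C * (F5 0 * F6 i) = 0.
Proof.
rewrite /F2 /F4 /F5 !F0 !mulr1 mul1r.
transitivity (a * (c - d) * (1 - d) * ((1 + c - a) * F1 i)
  - (c - a) * (1 - a) * (1 + c - d) * (d * F3 i)
  - (a - d) * (1 + c - a - d) * (c * F6 i)); first by rewrite /A /B /C; ring.
rewrite F1E F3E F6E /G1 /G3 /G6.
by field; do ?[apply/andP; split].
Qed.

(** The factor [c + y] in the last summand arises because [F3 j] brings (c+1)_j where [F2], [F4],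
    [F5] bring (c)_j. *)
Let Q x y := a * (c - d) * (1 - d) * G1 x * G2 y
  - (c - a) * (1 - a) * (1 + c - d) * G3 x * G4 y
  - (a - d) * (1 + c - a - d) * G6 x * G5 y
  - (a - d) * (1 + c - a - d) / ((c - d) * (1 - a)) * G1 x * G3 y * (c + y).

Let t i j := A * (F1 i * F2 j.+1) - B * (F3 i * F4 j.+1) - C * (F5 j.+1 * F6 i)
  - D * (F1 i * F3 j).

Let tE i j : t i j = (c - 1) ^+ 2 * E * (w i * w j)
  * (rising (c + 1) i * rising c j * Q i%:R j%:R).
Proof.
transitivity (a * (c - d) * (1 - d) * ((1 + c - a) * F1 i) * F2 j.+1
  - (c - a) * (1 - a) * (1 + c - d) * (d * F3 i) * F4 j.+1
  - (a - d) * (1 + c - a - d) * (c * F6 i) * F5 j.+1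
  - (a - d) * (1 + c - a - d) / ((c - d) * (1 - a)) * E * (c - 1) ^+ 2 * c
    * ((1 + c - a) * F1 i) * (d * F3 j)).
  by rewrite /t /A /B /C /D /E !invfM; ring.
rewrite F1E !F3E F6E F2E F4E F5E.
transitivity ((c - 1) ^+ 2 * E * (w i * w j) * rising (c + 1) i * (
  rising c j * (a * (c - d) * (1 - d) * G1 i%:R * G2 j%:R
  - (c - a) * (1 - a) * (1 + c - d) * G3 i%:R * G4 j%:R
  - (a - d) * (1 + c - a - d) * G6 i%:R * G5 j%:R)
  - (a - d) * (1 + c - a - d) / ((c - d) * (1 - a)) * G1 i%:R * G3 j%:R
    * (c * rising (c + 1) j))); first by ring.
by rewrite cri /Q; ring.
Qed.

(* The factor c + x comes from c * (c + 1)_i = (c)_i * (c + i), which makes the *)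
(* non-symmetric factor (c + 1)_i (c)_j of tE symmetric. *)
Let Q_antisym i j :
  (c + i%:R) * Q i%:R j%:R + (c + j%:R) * Q j%:R i%:R = 0.
Proof.
rewrite /Q /G1 /G2 /G3 /G4 /G5 /G6.
by field; do ?[apply/andP; split].
Qed.

(** Antisymmetry alone gives this only when c + i is nonzero, so the diagonal is computed
    directly. *)
Let Q_diag i : Q i%:R i%:R = 0.
Proof.
rewrite /Q /G1 /G2 /G3 /G4 /G5 /G6.
by field; do ?[apply/andP; split].
Qed.

Let t_antisym i j : t i j + t j i = 0.
Proof.
have [-> | ij] := eqVneq i j; first by rewrite tE Q_diag !mulr0 addr0.
have [c0 | c0] := eqVneq c 0.
  (* (0)_{k+1} = 0, so that only i = j = 0 would contribute. *)
  have w0 k : w k.+1 = 0 by rewrite /w [rising c _]risingSl c0; ring.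
  by case: i j ij => [|i] [|j]// _; rewrite !tE w0; ring.
apply: (mulfI c0); rewrite mulr0 !tE.
transitivity ((c - 1) ^+ 2 * E * (w i * w j)
  * (c * rising (c + 1) i * rising c j * Q i%:R j%:R
    + c * rising (c + 1) j * rising c i * Q j%:R i%:R)); first by ring.
rewrite !cri; transitivity ((c - 1) ^+ 2 * E * (w i * w j)
  * (rising c i * rising c j)
  * ((c + i%:R) * Q i%:R j%:R + (c + j%:R) * Q j%:R i%:R)); first by ring.
by rewrite Q_antisym mulr0.
Qed.

Let sum_t n : \sum_(i < n.+1) t i (n - i)%N = 0.
Proof.
set S := LHS; have : S + S = 0.
  rewrite {2}/S (reindex_inj rev_ord_inj) -big_split big1//= => i _.
  by rewrite subSS subKn ?leq_ord// t_antisym.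
by move/eqP; rewrite -mulr2n mulrn_eq0 => /eqP.
Qed.

Lemma hypergeom_quadratic n :
  A * fps_mul F1 F2 n - B * fps_mul F3 F4 n - C * fps_mul F5 F6 n
  = D * fps_mulX (fps_mul F1 F3) n.
Proof.
apply/eqP; rewrite -subr_eq0; apply/eqP.
(* Commuting [F5] and [F6] lets the summation index run over the factor with e + 1, f + 1 in every
   product; the last summand is then the boundary term. *)
rewrite [fps_mul F5 F6]fps_mulC /fps_mul !big_ord_recr /= subnn.
rewrite !mulrDr !opprD.
have := last_term_eq0 n; rewrite [F5 0 * _]mulrC => last0.
rewrite (_ : forall p q r x y z v : K,
  p + x + (- q - y) + (- r - z) - v = (p - q - r - v) + (x - y - z)); last first.
  by move=> *; ring.
rewrite last0 addr0 !mulr_sumr -!sumrB.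
case: n {last0} => [|n]; first by rewrite big_ord0 mulr0 subr0.
rewrite mulr_sumr -sumrB -[RHS](sum_t n); apply: eq_bigr => i _.
by rewrite subSn ?leq_ord// /t [F5 _ * _]mulrC.
Qed.
End Coefficients.

(** * Cesaro means and evaluation at a point *)

Section cesaro_fps.
Variable K : numFieldType.
(** An Archimedean property, which can fail in a general [numFieldType]. *)
Hypothesis harmonic0 : @harmonic K @ \oo --> (0 : K).
Implicit Types x u v : nat -> K.

Lemma cvg_mean_norm0 x : x @ \oo --> (0 : K) ->
  (fun n => (\sum_(i < n.+1) `|x i|) / n.+1%:R) @ \oo --> (0 : K).
Proof.
move=> x0; apply/cvgrPdist_lt => e e0.
have e2 : 0 < e / 2 by rewrite divr_gt0.
move/cvgrPdist_lt : (x0) => /(_ _ e2) [m _ xm].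
pose s := \sum_(i < m) `|x i|.
have s0 : 0 <= s by rewrite sumr_ge0.
(* The first m terms have the fixed sum [s], made small by the divisor; [s + 1] avoids dividing by
   zero. *)
have se : 0 < e / 2 / (s + 1) by rewrite divr_gt0// ltr_wpDl.
move/cvgrPdist_lt : harmonic0 => /(_ _ se) [p _ hp].
exists (maxn m p) => // n /=; rewrite geq_max => /andP[mn pn].
rewrite sub0r normrN ger0_norm ?divr_ge0 ?sumr_ge0//.
have := hp n pn; rewrite /= sub0r normrN ger0_norm ?invr_ge0// => hn.
have -> : \sum_(i < n.+1) `|x i| = s + \sum_(m <= i < n.+1) `|x i|.
  rewrite -(big_mkord xpredT (fun i => `|x i|)) (big_cat_nat (n := m))//.
    by rewrite big_mkord.
  exact: leqW.
rewrite mulrDl (splitr e) ltr_leD//.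
  apply: (@le_lt_trans _ _ ((s + 1) * n.+1%:R^-1)).
    by rewrite ler_wpM2r ?invr_ge0// lerDl.
  by rewrite mulrC -ltr_pdivlMr// ltr_wpDl.
rewrite ler_pdivrMr ?ltr0n//.
apply: (@le_trans _ _ (\sum_(m <= i < n.+1) (e / 2))).
  rewrite !big_nat; apply: ler_sum => i /andP[mi _].
  by have := xm i mi; rewrite /= sub0r normrN => /ltW.
by rewrite sumr_const_nat -[leLHS]mulr_natr (ler_wpM2l (ltW e2))//
  ler_nat leq_subr.
Qed.

(** Write u_i v_j - ab = (u_i - a) v_j + a (v_j - b) with j = n - i: as v is bounded, both parts are
    controlled by means of null sequences. *)
Lemma cesaro_fps_mul u v (a b : K) :
  u @ \oo --> a -> v @ \oo --> b ->
  (fun n => fps_mul u v n / n.+1%:R) @ \oo --> a * b.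
Proof.
move=> ua vb.
have [M M0 vM] : exists2 M : K, 0 < M & forall n, `|v n| <= M.
  have /cvg_seq_bounded/ex_strict_bound_gt0 [M M0 vM] : cvgn v.
    by apply/cvg_ex; exists b.
  by exists M => // n; apply/ltW/vM.
have u0 : (fun n => u n - a) @ \oo --> (0 : K) by apply/subr_cvg0.
have v0 : (fun n => v n - b) @ \oo --> (0 : K) by apply/subr_cvg0.
have : (fun n => M * ((\sum_(i < n.+1) `|u i - a|) / n.+1%:R)
    + `|a| * ((\sum_(i < n.+1) `|v i - b|) / n.+1%:R)) @ \oo --> M * 0 + `|a| * 0.
  by apply: cvgD; apply: cvgMl_tmp;
    [exact: (cvg_mean_norm0 u0)|exact: (cvg_mean_norm0 v0)].
rewrite !mulr0 addr0 => /cvgrPdist_lt h.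
apply/cvgrPdist_lt => e /h; apply: filterS => n.
rewrite sub0r normrN => /le_lt_trans; apply.
rewrite [leRHS]ger0_norm; last first.
  by rewrite addr_ge0// mulr_ge0// ?divr_ge0 ?sumr_ge0// ltW.
rewrite distrC.
have n0 : n.+1%:R != 0 :> K by rewrite pnatr_eq0.
have -> : fps_mul u v n / n.+1%:R - a * b =
    (\sum_(i < n.+1) ((u i - a) * v (n - i)%N + a * (v (n - i)%N - b)))
      / n.+1%:R.
  apply: (mulIf n0); rewrite mulrBl !divfK// mulr_natr -[n.+1 in LHS]card_ord.
  rewrite -sumr_const -sumrB; apply: eq_bigr => i _; ring.
rewrite normrM [`|_^-1|]ger0_norm ?invr_ge0// !mulrA -mulrDl.
rewrite ler_wpM2r ?invr_ge0//.
rewrite (le_trans (ler_norm_sum _ _ _))// !mulr_sumr.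
rewrite [X in _ <= _ + X](reindex_inj rev_ord_inj) -big_split /=.
apply: ler_sum => i _; rewrite subSS (le_trans (ler_normD _ _))// !normrM.
by rewrite lerD// mulrC ler_wpM2r.
Qed.

(** The sum of the first n partial sums is divided by n + 1, the number of terms in the convolution
    of partial sums that it equals for a Cauchy product. *)
Let mean2 u z n := series (series (fun k => u k * z ^+ k)) n / n.+1%:R.

Lemma cvg_fps_eval u z : fps_cvg_at u z ->
  series (fun k => u k * z ^+ k) @ \oo --> fps_eval u z.
Proof. by []. Qed.

Lemma cvg_fps_eval_mulX u z : fps_cvg_at u z ->
  series (fun k => fps_mulX u k * z ^+ k) @ \oo --> z * fps_eval u z.
Proof.
move=> /cvg_fps_eval uz; rewrite -cvg_shiftS.
rewrite (_ : (fun n => _) = (fun n => z * series (fun k => u k * z ^+ k) n)).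
  exact: cvgMl_tmp.
apply/funext => n; rewrite /series /= big_nat_recl// mul0r add0r mulr_sumr.
by apply: eq_bigr => k _; rewrite exprS mulrCA.
Qed.

Lemma cesaro_fps_eval u v z (a b : K) :
  series (fun k => u k * z ^+ k) @ \oo --> a ->
  series (fun k => v k * z ^+ k) @ \oo --> b ->
  mean2 (fps_mul u v) z @ \oo --> a * b.
Proof.
move=> ua vb; have := cesaro_fps_mul ua vb.
by rewrite fps_mul_series fps_mulC fps_mul_series [fps_mul _ _]fps_mulC
  fps_mul_dilate.
Qed.

Lemma fps_eval_quadratic (u1 u2 u3 u4 u5 u6 : nat -> K) (A B C D z : K) :
  (forall n, A * fps_mul u1 u2 n - B * fps_mul u3 u4 n - C * fps_mul u5 u6 n
    = D * fps_mulX (fps_mul u1 u3) n) ->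
  fps_cvg_at u1 z -> fps_cvg_at u2 z -> fps_cvg_at u3 z ->
  fps_cvg_at u4 z -> fps_cvg_at u5 z -> fps_cvg_at u6 z ->
  A * (fps_eval u1 z * fps_eval u2 z) - B * (fps_eval u3 z * fps_eval u4 z)
    - C * (fps_eval u5 z * fps_eval u6 z)
  = z * D * (fps_eval u1 z * fps_eval u3 z).
Proof.
move=> coefE c1 c2 c3 c4 c5 c6.
have l12 := cesaro_fps_eval (cvg_fps_eval c1) (cvg_fps_eval c2).
have l34 := cesaro_fps_eval (cvg_fps_eval c3) (cvg_fps_eval c4).
have l56 := cesaro_fps_eval (cvg_fps_eval c5) (cvg_fps_eval c6).
(* The factor z is absorbed into [u1], so the right-hand side is also a Cauchy product. *)
have l13 := cesaro_fps_eval (cvg_fps_eval_mulX c1) (cvg_fps_eval c3).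
have lhs : (fun n => A * mean2 (fps_mul u1 u2) z n
    - B * mean2 (fps_mul u3 u4) z n - C * mean2 (fps_mul u5 u6) z n) @ \oo -->
    A * (fps_eval u1 z * fps_eval u2 z) - B * (fps_eval u3 z * fps_eval u4 z)
    - C * (fps_eval u5 z * fps_eval u6 z).
  by apply: cvgB; [apply: cvgB|]; apply: cvgMl_tmp.
have rhs : (fun n => D * mean2 (fps_mul (fps_mulX u1) u3) z n) @ \oo -->
    D * (z * fps_eval u1 z * fps_eval u3 z) by apply: cvgMl_tmp.
rewrite [z * D]mulrC -mulrA [z * (_ * _)]mulrA.
apply: (cvg_unique (@norm_hausdorff _ _) lhs) => /=.
rewrite (_ : (fun n => _)
  = (fun n => D * mean2 (fps_mul (fps_mulX u1) u3) z n))//.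
apply/funext => n; rewrite /mean2 !mulrA -!mulrBl; congr (_ / _).
rewrite fps_mul_mulX /series /= !mulr_sumr -!sumrB; apply: eq_bigr => m _.
rewrite !mulr_sumr -!sumrB; apply: eq_bigr => k _.
by rewrite !mulrA -!mulrBl coefE.
Qed.
End cesaro_fps.

Lemma cvg_harmonic_complex (R : realType) :
  let K : numFieldType := R[i] in @harmonic K @ \oo --> (0 : K).
Proof.
move=> K; apply/cvgrPdist_lt => e e0.
(* A positive element of [R[i]] is real, which reduces the claim to [R]. *)
have [b e_b] : exists b : R, e = b%:C%C.
  by exists (complex.Re e); rewrite RRe_real// gtr0_real.
have b0 : 0 < b by rewrite -ltcR -e_b.
have := @cvg_harmonic R; move=> /cvgrPdist_lt /(_ b b0).
apply: filterS => n /=.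
rewrite !sub0r !normrN !gtr0_norm ?invr_gt0 ?ltr0n// e_b -ltcR.
by rewrite fmorphV rmorph_nat.
Qed.

Theorem theorem4p1 (R : realType) (r s : nat) (a c d : R[i])
    (e : r.-tuple R[i]) (f : s.-tuple R[i]) :
  (r <= s)%N ->
  let e1 := [seq x + 1 | x <- e] in
  let f1 := [seq y + 1 | y <- f] in
  let L1 := [:: a; 2; c - d + 2] ++ f1 in
  let L2 := [:: 1; a; c - d] ++ f in
  let L3 := [:: a + 1; 2; c - d + 1] ++ f1 in
  let L4 := [:: 1; a - 1; c - d + 1] ++ f in
  let L5 := [:: a - 1; 1; c - d] ++ f in
  let L6 := [:: a + 1; 1; c - d + 2] ++ f1 in
  nonpole L1 -> nonpole L2 -> nonpole L3 ->
  nonpole L4 -> nonpole L5 -> nonpole L6 ->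
  let F1 := hypergeom ([:: c - a + 2; 1 + c; c; d] ++ e1) L1 in
  let F2 := hypergeom ([:: c - a; c - 1; c - 1; d] ++ e) L2 in
  let F3 := hypergeom ([:: c - a + 1; c; c + 1; d + 1] ++ e1) L3 in
  let F4 := hypergeom ([:: c - a + 1; c - 1; c - 1; d - 1] ++ e) L4 in
  let F5 := hypergeom ([:: 1 + c - a; c - 1; c - 1; d] ++ e) L5 in
  let F6 := hypergeom ([:: 1 + c - a; 1 + c; c + 1; d] ++ e1) L6 in
  let A := a * (c - d) * (1 - d) * (1 + c - a) in
  let B := d * (c - a) * (1 - a) * (1 + c - d) in
  let C := c * (a - d) * (1 + c - a - d) in
  let D := d * c * (a - d) * (1 + c - a - d) * (1 + c - a) * (c - 1) ^+ 2
             * (\prod_(x <- e) x)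
           / ((c - d) * (1 - a) * (\prod_(y <- f) y)) in
  (forall n : nat,
     A * fps_mul F1 F2 n - B * fps_mul F3 F4 n - C * fps_mul F5 F6 n
     = D * fps_mulX (fps_mul F1 F3) n)
  /\
  (forall z : R[i],
     fps_cvg_at F1 z -> fps_cvg_at F2 z -> fps_cvg_at F3 z ->
     fps_cvg_at F4 z -> fps_cvg_at F5 z -> fps_cvg_at F6 z ->
     A * (fps_eval F1 z * fps_eval F2 z)
     - B * (fps_eval F3 z * fps_eval F4 z)
     - C * (fps_eval F5 z * fps_eval F6 z)
     = z * D * (fps_eval F1 z * fps_eval F3 z)).

Proof.
move=> _ e1 f1 L1 L2 L3 L4 L5 L6 _ _ _ _ pole5 _ F1 F2 F3 F4 F5 F6 A B C D.
have coefE n : A * fps_mul F1 F2 n - B * fps_mul F3 F4 n - C * fps_mul F5 F6 n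
    = D * fps_mulX (fps_mul F1 F3) n.
  apply: hypergeom_quadratic => k.
  (* [a - 1] and [c - d] are both lower parameters of [F5]. *)
  - by apply: pole5; rewrite mem_head.
  - by apply: pole5; rewrite !inE eqxx !orbT.
split=> // z; exact: (fps_eval_quadratic (@cvg_harmonic_complex R) coefE).
Qed.
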